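(* For each infinite cardinal $\kappa$ there exists an infinite regular $\kappa$-bounded space $R_{\kappa}$ such that for every $T_1$ space $Y$ of pseudo-character $\psi(Y)\leq \kappa$, each continuous map $f:R_{\kappa}\rightarrow Y$ is constant.
   Context: Regular spaces are assumed to be $T_1$ (Engelking's convention). A topological space $X$ is called $\kappa$-bounded if the closure of each subset $A\subset X$ of cardinality $\leq \kappa$ is compact. The pseudo-character $\psi(Y)$ of a $T_1$ space $Y$ is the smallest infinite cardinal $\lambda$ such that for each point $y\in Y$ the set $\{y\}$ is the intersection of a family of cardinality $\leq\lambda$ of open subsets of $Y$. *)

(* Defs.v *)
From mathcomp Require Import all_boot all_order.
From mathcomp Require Import all_classical topology.

Set Implicit Arguments.
Unset Strict Implicit.
Unset Printing Implicit Defensive.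

Local Open Scope classical_set_scope.
Local Open Scope card_scope.

(* A cardinal is represented by a type K, standing for |K|; cardinals are
   compared by [#<=] on the full sets. *)

(* [compact] is the covering notion, without any separation axiom; when X is
   Hausdorff, so is each closure, and the convention that compact spaces are
   Hausdorff makes no difference. *)
Definition card_bounded (K : Type) (X : topologicalType) : Prop :=
  forall A : set X, A #<= [set: K] -> compact (closure A).

Definition local_pseudobases_le (L : Type) (Y : topologicalType) : Prop :=
  forall y : Y, exists F : set (set Y),
    [/\ F #<= [set: L], (forall U, F U -> open U) &
        \bigcap_(U in F) U = [set y]].

(* psi(Y) = |L|.  The least cardinal is determined up to equipotence only,
   hence a relation; [pseudo_character_ex] shows that it is total on T1
   spaces. *)
Definition is_pseudo_character (Y : topologicalType) (L : Type) : Prop :=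
  [/\ infinite_set [set: L], local_pseudobases_le L Y &
      forall M : Type, infinite_set [set: M] -> local_pseudobases_le M Y ->
        [set: L] #<= [set: M]].

Lemma inj_card_leT (T U : Type) (f : T -> U) :
  injective f -> [set: T] #<= [set: U].
Proof.
move=> fI; have /injfunPex[g] : exists2 g : T -> U,
    set_fun [set: T] [set: U] g & set_inj [set: T] g.
  by exists f => // x y _ _; exact: fI.
exact: inj_card_le.
Qed.

Lemma card_leT_inj (T U : Type) :
  [set: T] #<= [set: U] -> exists f : T -> U, injective f.
Proof.
move=> /card_leP[f].
exists (fun x => val (f (SigSub (mem_set (I : [set: T] x))))) => x y.
move=> /val_inj /(@inj _ _ _ f); rewrite !in_setT => /(_ isT isT).
by move=> /(congr1 val).
Qed.

(* Any nonempty family of cardinals has a least element: take a maximal set of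
   choice functions on which all the coordinates are injective. *)
Lemma card_le_min (I : Type) (F : I -> Type) (i0 : I) :
  exists i, forall j, [set: F i] #<= [set: F j].
Proof.
pose P (G : set (forall i, F i)) :=
  forall x y i, G x -> G y -> x i = y i -> x = y.
have [E EP Etot|G [PG Gmax]] := @Zorn_bigcup _ P.
  move=> x y i [A EA Ax] [B EB By]; have [AB|BA] := Etot _ _ EA EB.
    by apply: (EP B EB) => //; exact: AB.
  by apply: (EP A EA) => //; exact: BA.
have [[i Gi]|nsurj] := pselect (exists i, forall z, exists x, G x /\ x i = z).
  exists i => j; have [s sP] := choice Gi.
  apply: (@inj_card_leT _ _ (fun z => s z j)) => z t /= st.
  have [[Gz <-] [Gt <-]] := (sP z, sP t).
  by rewrite (PG _ _ j Gz Gt st).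
have ex_y : forall i, exists z : F i, forall x, G x -> x i <> z.
  move=> i; apply/not_existsP => h; apply: nsurj; exists i => z.
  by apply/not_existsP => h'; apply: (h z) => x Gx xz; exact: (h' x).
pose y i := sval (cid (ex_y i)).
have yP i x : G x -> x i <> y i by exact: (svalP (cid (ex_y i))).
exfalso; apply: (Gmax (G `|` [set (y : forall i, F i)])).
  split=> [x Gx|]; first by left.
  by move=> /(_ y (or_intror erefl)) Gy; exact: (yP i0 y Gy).
move=> u v i [Gu|->] [Gv|->] // e.
- exact: PG e.
- by case: (yP i u Gu e).
- by case: (yP i v Gv (esym e)).
Qed.

Lemma local_pseudobases_leW (Y : topologicalType) (L M : Type) :
  [set: L] #<= [set: M] ->
  local_pseudobases_le L Y -> local_pseudobases_le M Y.
Proof.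
move=> LM LY y; have [F [FL Fo FE]] := LY y.
by exists F; split=> //; exact: card_le_trans FL LM.
Qed.

Lemma pseudo_character_ex (Y : topologicalType) :
  accessible_space Y -> exists L : Type, is_pseudo_character Y L.
Proof.
move=> T1Y; pose L0 := (set Y + nat)%type.
have infW (T U : Type) :
    [set: T] #<= [set: U] -> infinite_set [set: T] -> infinite_set [set: U].
  by move=> TU Tinf /(card_le_finite TU).
have L0inf : infinite_set [set: L0].
  by apply/infiniteP; apply: (@inj_card_leT _ _ inr) => ? ? [].
have L0Y : local_pseudobases_le L0 Y.
  move=> y; exists [set U | open U /\ U y]; split=> [|U []//|].
    apply: (card_le_trans (subset_card_le (@subsetT _ _))).
    by apply: (@inj_card_leT _ _ inl) => ? ? [].
  rewrite eqEsubset; split=> [x xU|_ -> U []//]; apply: contrapT => /= /eqP.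
  rewrite eq_sym => /T1Y[U [Uo]]; rewrite !inE => Uy.
  by apply; exact: xU.
pose good (A : set L0) :=
  infinite_set [set: A] /\ local_pseudobases_le A Y.
have good_sub (M : Type) : [set: M] #<= [set: L0] ->
    infinite_set [set: M] -> local_pseudobases_le M Y ->
    exists2 A : set L0, good A & [set: A] #<= [set: M].
  move=> /card_leT_inj[f fI] Minf MY; exists (range f).
    have Mf : [set: M] #<= [set: range f].
      apply: (@inj_card_leT _ _
        (fun x => SigSub (mem_set (imageP f (I : [set: M] x))))) => x y.
      by move=> /(congr1 val) /fI.
    by split; [exact: infW Mf _|exact: local_pseudobases_leW Mf _].
  by rewrite (card_le_eql (card_setT _)); exact: card_image_le.
have [A0 A0good _] := good_sub L0 (card_lexx _) L0inf L0Y.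
have [[A [Ainf AY]] Amin] :=
  @card_le_min {A : set L0 | good A} (fun A => sval A) (exist _ A0 A0good).
exists A; split=> // M Minf MY.
have [[] h] := @card_le_min bool (fun b => if b then M else L0) true.
  have [B Bgood BM] := good_sub M (h false) Minf MY.
  exact: card_le_trans (Amin (exist _ B Bgood)) BM.
apply: card_le_trans (h true); rewrite (card_le_eql (card_setT _)).
exact: card_leT.
Qed.

(* Main.v *)
(** Let T be a regular space in which the closure of a union of at most K
    compact sets is compact, with points a <> b that no continuous map into a
    T1 space of pseudo-character at most K separates.  Take the compact subsets
    of T that contain b, with the Vietoris topology, and collapse those that
    also contain a to a single point p whose neighborhoods are generated by the
    sets of all compact sets meeting a given neighborhood of a.  For a compact
    set M containing b but not a, the map sending t to M `|` [set t] (and a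
    to p) is continuous from T; it takes the value M at b and p at a.  Hence
    every continuous map into Y takes the same value at M and at p.

    T is a Tychonoff corkscrew built on C1 * C2, where o1 and o2 are points of
    compact spaces such that any K (for o2, also any |C1|) neighborhoods of the
    point intersect in a neighborhood.  A map f with G_K fibers is constant
    near o2 on each line {x} * C2, uniformly in x, and then near o1 on a line
    C1 * {y0}; so f takes a single value at some point (x0, y0) of all planks,
    hence at both ends of the corkscrew.  For C1 and C2, take a preorder without
    largest element in which families of the required size are bounded; its
    down-closed subsets form a closed subspace of a power of {0, 1}, in which
    the full set is the point wanted. *)

Require Import Defs.
From HB Require Import structures.
From mathcomp Require Import all_boot all_order all_algebra.
From mathcomp Require Import all_classical topology.
From mathcomp Require Import zify.

Set Implicit Arguments.
Unset Strict Implicit.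
Unset Printing Implicit Defensive.

Local Open Scope classical_set_scope.
Local Open Scope card_scope.

(** * Topologies generated by a subbase *)

Definition generated {T : Type} (B : set_system T) : Type := T.

(** Taking the smallest filter avoids finite intersections: inclusions and limits are tested on
    subbasic sets only. *)
Definition generated_nbhs {T : Type} (B : set_system T) (p : generated B) :
    set_system (generated B) :=
  smallest Filter [set U : set T | B U /\ U p].

Lemma generated_nbhsS {T : Type} (B : set_system T) (p : generated B)
    (F : set_system T) : Filter F ->
  (forall U : set T, B U -> U p -> F U) -> generated_nbhs p `<=` F.
Proof. by move=> FF BF; apply: smallest_sub => // U [/BF]; exact. Qed.

Lemma generated_nbhs_sub {T : Type} (B : set_system T) (p : generated B)
  (U : set T) : B U -> U p -> generated_nbhs p U.
Proof. by move=> BU Up; apply: sub_gen_smallest. Qed.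

Lemma generated_nbhs_is_filter {T : Type} (B : set_system T)
  (p : generated B) : Filter (generated_nbhs p).
Proof. exact: (smallest_filter_filter [set U : set T | B U /\ U p]). Qed.

Lemma generated_nbhs_singleton {T : Type} (B : set_system T)
  (p : generated B) (A : set (generated B)) : generated_nbhs p A -> A p.
Proof.
move=> pA; suff : principal_filter p A by move/principal_filterP.
by apply: (generated_nbhsS _ _ pA) => U _ Up; apply/principal_filterP.
Qed.

Lemma generated_nbhs_filter {T : Type} (B : set_system T)
  (p : generated B) : ProperFilter (generated_nbhs p).
Proof.
apply: Build_ProperFilter_ex.
by move=> A pA; exists p; exact: generated_nbhs_singleton pA.
Qed.

(** The sets [A] satisfying the conclusion form a filter, and a subbasic set is a neighborhood of
    each of its points. *)
Lemma generated_nbhs_nbhs {T : Type} (B : set_system T)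
    (p : generated B) (A : set (generated B)) :
  generated_nbhs p A -> generated_nbhs p (@generated_nbhs T B ^~ A).
Proof.
have FF q : Filter (generated_nbhs q).
  exact: generated_nbhs_is_filter.
apply: (@generated_nbhsS _ _ _
  [set A : set (generated B) | generated_nbhs p (@generated_nbhs T B ^~ A)]).
  split=> /=.
  - by apply: filterE => q; exact: filterT.
  - move=> U V pU pV.
    apply: (@filterS2 _ (generated_nbhs p) _ _ _ _ _ pU pV) => q.
    exact: filterI.
  - move=> U V UV; apply: (@filterS _ (generated_nbhs p)) => q.
    exact: filterS UV.
move=> U BU Up /=; apply: (filterS _ (generated_nbhs_sub BU Up)) => q.
exact: generated_nbhs_sub.
Qed.

HB.instance Definition _ {T : Type} (B : set_system T) :=
  gen_eqMixin (generated B).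
HB.instance Definition _ {T : Type} (B : set_system T) :=
  gen_choiceMixin (generated B).
HB.instance Definition _ {T : Type} (B : set_system T) :=
  hasNbhs.Build (generated B) (@generated_nbhs T B).
HB.instance Definition _ {T : Type} (B : set_system T) :=
  Nbhs_isNbhsTopological.Build (generated B)
    (@generated_nbhs_filter T B) (@generated_nbhs_singleton T B)
    (@generated_nbhs_nbhs T B).

Lemma generated_cvg {T : Type} (B : set_system T) (p : generated B)
    (F : set_system (generated B)) : Filter F ->
  (forall U : set T, B U -> U p -> F U) -> F --> p.
Proof. exact: generated_nbhsS. Qed.

Lemma generated_open {T : Type} (B : set_system T) (U : set T) :
  B U -> open (U : set (generated B)).
Proof. by move=> BU; rewrite openE => p Up; exact: generated_nbhs_sub. Qed.

(** * P-points and compact spaces of down-closed sets *)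

(** For [I = nat] this is the classical P-point; the index type stands for a cardinal. *)
Definition P_point (I : Type) (X : topologicalType) (o : X) : Prop :=
  forall g : I -> set X, (forall i, nbhs o (g i)) -> nbhs o (\bigcap_i g i).

Lemma P_point_inj (I J : Type) (h : I -> J) (X : topologicalType) (o : X) :
  injective h -> P_point J o -> P_point I o.
Proof.
move=> hI Jo g go.
have : nbhs o (\bigcap_j \bigcap_(i in [set i | h i = j]) g i).
  apply: Jo => j; have [[i hi]|nj] := pselect (exists i, h i = j).
    apply: filterS (go i) => x gx k /= hk.
    by have -> : k = i by apply: hI; rewrite hk hi.
  by apply: filterS filterT => x _ k hk; case: nj; exists k.
by apply: filterS => x gx i _; exact: (gx (h i)).
Qed.

Section cut_space.
Variable J : Type.

Let M := nat -> J.
(** A member of [W] lists at most |M| subsets of [M]. Since |J * M| <= |M|, the ranges of [J]-many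
    lists fit into one list; by Cantor no list is exhaustive. *)
Let W := M -> set M.

Definition below (v w : W) : Prop := range v `<=` range w.

Record cut := Cut { 
  elems : set W; 
  cut_below : forall v w, below v w -> elems w -> elems v }.

Lemma cut_inj S S' : elems S = elems S' -> S = S'.
Proof.
by case: S S' => [S h] [S' h'] /= E; move: h h'; rewrite E => h h'; congr Cut.
Qed.

Definition cut_subbase : set_system cut :=
  [set U | exists w, U = [set S | elems S w] \/ U = [set S | ~ elems S w]].

Definition cut_space : topologicalType := generated cut_subbase.

Definition cut_top : cut_space := @Cut setT (fun _ _ _ _ => I).

(** An ultrafilter converges to its coordinatewise limit: the [w] that belong to almost every cut.
    This set is again down-closed. *)
Lemma cut_space_compact : compact [set: cut_space].
Proof.
rewrite compact_ultra => F FU _.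
have dF v w : below v w -> F [set S : cut | elems S w] ->
    F [set S : cut | elems S v].
  by move=> vw; apply: filterS => S; exact: cut_below.
exists (@Cut [set w | F [set S : cut | elems S w]] dF); split=> //=.
apply: (@generated_cvg _ cut_subbase) => U [w [->|->]] //= nF.
by have [] := in_ultra_setVsetC [set S : cut | elems S w] FU.
Qed.

Lemma cut_space_hausdorff : hausdorff_space cut_space.
Proof.
move=> S S' SS'; apply: cut_inj; apply/predeqP => w.
split=> Sw; apply: contrapT => S'w.
  have [] := SS' [set X : cut | elems X w] [set X : cut | ~ elems X w].
  - by apply: generated_nbhs_sub => //; exists w; left.
  - by apply: generated_nbhs_sub => //; exists w; right.
  by move=> X [].
have [] := SS' [set X : cut | ~ elems X w] [set X : cut | elems X w].
- by apply: generated_nbhs_sub => //; exists w; right.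
- by apply: generated_nbhs_sub => //; exists w; left.
by move=> X [].
Qed.

(* nat -> J maps onto J * (nat -> J), whence J-indexed upper bounds. *)
Lemma below_ub (w : J -> W) : exists u, forall j, below (w j) u.
Proof.
exists (fun m => w (m 0) (fun n => m n.+1)) => j _ [m _ <-].
by exists (fun n => if n is n'.+1 then m n' else j).
Qed.

(** The full cut lies in no negative subbasic set, and two positive ones contain a third by an upper
    bound; the indices [j0] and [j1] let [below_ub] bound a pair. *)
Lemma nbhs_cut_top (j0 j1 : J) (A : set cut_space) : j0 <> j1 ->
  nbhs cut_top A -> exists w, [set S : cut | elems S w] `<=` A.
Proof.
move=> j01.
apply: (@generated_nbhsS _ _ _ [set B : set cut | exists w, elems^~ w `<=` B])
  => [|_ [w [->|->]] /= nI]; [|by exists w|by []].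
split=> [|P Q [v vP] [w wQ]|P Q PQ [w wP]]; first by exists (fun=> set0).
  have [u uP] := below_ub (fun j => if `[< j = j0 >] then v else w).
  exists u => S Su; split; [apply: vP|apply: wQ].
    by apply: cut_below Su; have := uP j0; case: asboolP.
  by apply: cut_below Su; have := uP j1; case: asboolP => // /esym.
by exists w => S /wP /PQ.
Qed.

Lemma cut_top_P_point (j0 j1 : J) : j0 <> j1 -> P_point J cut_top.
Proof.
move=> j01 g go.
have /choice[w wP] j := nbhs_cut_top j01 (go j).
have [u uP] := below_ub w.
suff : nbhs cut_top [set S : cut_space | elems S u].
  apply: (@filterS _ (nbhs cut_top) (nbhs_filter _)) => S Su j _; apply: wP.
  exact: cut_below Su.
by apply: generated_nbhs_sub => //; exists u; left.
Qed.

Lemma cut_top_limit (j0 j1 : J) (A : set cut_space) : j0 <> j1 ->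
  nbhs cut_top A -> exists2 S, A S & S <> cut_top.
Proof.
move=> j01 /(nbhs_cut_top j01)[w wA].
(* The principal down-set of [w] is not full: otherwise the constant list at the diagonal set would
   be below [w], and [w] would list its own diagonal. *)
pose S := @Cut [set v | below v w] (fun _ _ uv vw => subset_trans uv vw).
exists S; first by apply: wA => /=.
move=> /(congr1 elems) /= E.
have : [set v | below v w] (fun _ => [set m | ~ w m m]) by rewrite E.
case/(_ _ (imageP _ (I : setT (fun=> j0)))) => m _ wm.
have : w m m <-> ~ w m m by rewrite {1}wm.
by case=> h h'; have n : ~ w m m by [move=> k; exact: (h k) k]; exact: n (h' n).
Qed.

End cut_space.

(** * Regular spaces and compact sets *)

Lemma regular_accessible_hausdorff (T : topologicalType) :
  accessible_space T -> regular_space T -> hausdorff_space T.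
Proof.
move=> T1 Treg p q pq; apply: contrapT => npq.
have : p != q by apply/eqP.
move=> /T1[A [oA]]; rewrite !inE => Ap; apply.
have [B pB BA] := Treg p _ (open_nbhs_nbhs (conj oA Ap)).
by apply: BA => C qC; exact: pq.
Qed.

(** As these sets form a filter, regularity at [x] can be checked on a subbase. *)
Lemma filter_closure_nbhs (T : topologicalType) (x : T) :
  Filter (filter_from (nbhs x) closure).
Proof.
apply: filter_from_filter; first by exists setT; exact: filterT.
by move=> P Q xP xQ; exists (P `&` Q); [exact: filterI|exact: closureI].
Qed.

Lemma regular_open_nbhs (T : topologicalType) (x : T) (U : set T) :
  regular_space T -> open U -> U x ->
  exists V, [/\ open V, V x & closure V `<=` U].
Proof.
move=> Treg oU Ux; have [V xV VU] := Treg x _ (open_nbhs_nbhs (conj oU Ux)).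
exists V°; split; first exact: open_interior.
  exact: xV.
by apply: subset_trans VU; apply: closureS; exact: interior_subset.
Qed.

Lemma regular_compact_nbhs (T : topologicalType) (K U : set T) :
  regular_space T -> compact K -> open U -> K `<=` U ->
  exists V, [/\ open V, K `<=` V & closure V `<=` U].
Proof.
move=> Treg /compact_near_coveringP Kc oU KU.
pose good V := open V /\ closure V `<=` U.
(* Good sets are directed by union; [F] is the filter of eventually large good sets. *)
pose F := filter_from good (fun V0 => [set V | good V /\ V0 `<=` V]).
have FF : Filter F.
  apply: filter_from_filter.
    by exists set0; split; [exact: open0|rewrite closure0; exact: sub0set].
  move=> V W [oV VU] [oW WU]; exists (V `|` W).
    by split; [exact: openU|rewrite closureU subUset].
  by move=> X [gX]; rewrite subUset => -[].
have [x Kx|V0 gV0 V0K] := Kc _ F (fun V x => V x) FF.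
  have [V [oV Vx VU]] := regular_open_nbhs Treg oU (KU _ Kx).
  exists (V, [set V' | good V' /\ V `<=` V']) => /=.
    by split; [exact: open_nbhs_nbhs|exists V].
  by move=> [y W] [/= Vy [_]]; apply.
by exists V0; have [oV VU] := gV0; split=> //; apply: V0K; split.
Qed.

Lemma card_le_range (K T : Type) (A : set T) :
  A !=set0 -> A #<= [set: K] -> exists e : K -> T, A = range e.
Proof.
move=> A0 /pfcard_geP[A_eq0|/surjfunPex//].
by move: A0; rewrite A_eq0 => -[].
Qed.

(** * The hyperspace of compact sets with a collapsed point *)

Section continua.
Variables (T : topologicalType) (a b : T).

(* The point to which the compact sets containing a are collapsed is
   represented by [set a; b]. *)
Record hyperpoint := Hyperpoint {
  points : set T;
  points_compact : compact points;
  points_b : points b;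
  points_a : points a -> points = [set a; b] }.

Lemma hyperpoint_inj K L : points K = points L -> K = L.
Proof.
by case: K L => [K ? ? ?] [L ? ? ?] /= E; subst L; congr Hyperpoint;
  exact: Prop_irrelevance.
Qed.

Definition inside (U : set T) : set hyperpoint := [set K | points K `<=` U].

(** The representative [[set a; b]] meets every neighborhood of [b]; the second clause admits the
    collapsed point only if [a] is in [U]. *)
Definition meeting (U : set T) : set hyperpoint :=
  [set K | points K `&` U !=set0 /\ (points K a -> U a)].

(** Since [inside U] is taken only when [U] misses [a], the collapsed point has only sets
    [meeting U] as subbasic neighborhoods. *)
Definition hyper_subbase : set_system hyperpoint :=
  [set W | exists2 U, open U & (~ U a /\ W = inside U) \/ W = meeting U].

Definition hyperspace : topologicalType := generated hyper_subbase.

Lemma open_inside U : open U -> ~ U a -> open (inside U : set hyperspace).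
Proof. by move=> oU Ua; apply: generated_open; exists U => //; left. Qed.

Lemma open_meeting U : open U -> open (meeting U : set hyperspace).
Proof. by move=> oU; apply: generated_open; exists U => //; right. Qed.

Lemma hyperspace_cvg (F : set_system hyperspace) (K : hyperspace) : Filter F ->
  (forall U, open U -> ~ U a -> inside U K -> F (inside U)) ->
  (forall U, open U -> meeting U K -> F (meeting U)) -> F --> K.
Proof.
move=> FF FI FM; apply: generated_cvg => _ [U oU [[Ua ->]|->]]; first exact: FI.
exact: FM.
Qed.

Definition hyper_collapsed : hyperspace.
Proof.
exists [set a; b] => //; last by right.
by apply: compactU; exact: compact_set1.
Defined.

Hypotheses (T1 : accessible_space T) (Treg : regular_space T).

Let Thaus : hausdorff_space T := regular_accessible_hausdorff T1 Treg.

Let points_closed (K : hyperspace) : closed (points K).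
Proof. exact: compact_closed Thaus (@points_compact K). Qed.

Lemma hyper_collapsedP (K : hyperspace) : points K a -> K = hyper_collapsed.
Proof. by move=> Ka; apply: hyperpoint_inj; exact: points_a Ka. Qed.

Lemma accessible_hyperspace : accessible_space hyperspace.
Proof.
move=> K L /eqP KL; suff [U [oU UK UL]] : exists U, [/\ open U, U K & ~ U L].
  by exists U; rewrite !inE.
have [Ka|nKa] := pselect (points K a).
  have nLa : ~ points L a.
    by move=> /hyper_collapsedP; rewrite -(hyper_collapsedP Ka) => /esym.
  exists (meeting (~` points L)); split.
  - by apply: open_meeting; exact/closed_openC/points_closed.
  - by split=> //; exists a.
  - by move=> [[x [Lx]]].
have [/existsNP[x /not_implyP[Kx nLx]]|/contrapT KLs] :=
  pselect (~ (points K `<=` points L)).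
  exists (meeting (~` points L)); split.
  - by apply: open_meeting; exact/closed_openC/points_closed.
  - by split=> //; exists x.
  - by move=> [[y [Ly]]].
have [x Lx nKx] : exists2 x, points L x & ~ points K x.
  apply: contrapT => h; apply: KL; apply: hyperpoint_inj.
  apply/seteqP; split=> // x Lx; apply: contrapT => nKx.
  by apply: h; exists x.
(* Removing [a] as well makes [open_inside] applicable. *)
exists (inside (~` [set x] `&` ~` [set a])); split.
- apply: open_inside; last by move=> [_ /(_ erefl)].
  by apply: openI; exact/closed_openC/accessible_closed_set1.
- move=> y Ky; split=> [yx|ya]; first by apply: nKx; rewrite -yx.
  by apply: nKa; rewrite -ya.
- by move=> /(_ _ Lx)[/(_ erefl)].
Qed.

(** The assumption on [a] makes [meeting] of the complement of [closure V] a neighborhood of [L]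
    even when [L] is the collapsed point. *)
Lemma closure_inside (V : set T) (L : hyperspace) : ~ closure V a ->
  closure (inside V : set hyperspace) L -> points L `<=` closure V.
Proof.
move=> Va VL x Lx; apply: contrapT => Vx.
have [|K [KV [[y [Ky Vy]] _]]] := VL (meeting (~` closure V)).
  apply: open_nbhs_nbhs; split.
    by apply: open_meeting; exact/closed_openC/closed_closure.
  by split=> //; exists x.
by apply: Vy; apply: subset_closure; exact: KV.
Qed.

Lemma closure_meeting (V : set T) (L : hyperspace) :
  closure (meeting V : set hyperspace) L ->
  points L a \/ points L `&` closure V !=set0.
Proof.
move=> VL; apply: contrapT => /not_orP[La LV].
have [|K [[[y [Ky Vy]] _] KV]] := VL (inside (~` closure V `&` ~` [set a])).
  apply: open_nbhs_nbhs; split.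
    apply: open_inside; last by move=> [_ /(_ erefl)].
    apply: openI; first exact/closed_openC/closed_closure.
    exact/closed_openC/accessible_closed_set1.
  move=> x Lx; split=> [Vx|xa]; first by apply: LV; exists x.
  by apply: La; rewrite -xa.
by have [/(_ (subset_closure Vy))] := KV _ Ky.
Qed.

Lemma regular_hyperspace : regular_space hyperspace.
Proof.
move=> K.
have FF := filter_closure_nbhs K.
apply: hyperspace_cvg => [U oU Ua KU|U oU [KU KUa]].
  have [V [oV KV VU]] := regular_compact_nbhs Treg (@points_compact K) oU KU.
  have Va : ~ closure V a by move=> /VU.
  exists (inside V).
    apply: open_nbhs_nbhs; split=> //; apply: open_inside => // /subset_closure.
    exact: Va.
  by move=> L /(closure_inside Va) /subset_trans; exact.
have [Ka|nKa] := pselect (points K a).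
  have [V [oV Va VU]] := regular_open_nbhs Treg oU (KUa Ka).
  exists (meeting V).
    by apply: open_nbhs_nbhs; split; [exact: open_meeting|split=> //; exists a].
  move=> L /closure_meeting[La|[x [Lx Vx]]].
    by split=> [|_]; [exists a; split=> //|]; exact: KUa.
  by split; [exists x; split=> //; exact: VU|move=> _; exact: KUa].
have [x [Kx Ux]] := KU.
have [V [oV Vx VU]] := regular_open_nbhs Treg oU Ux.
have oa : open (~` [set a]) by exact/closed_openC/accessible_closed_set1.
have Kna : points K `<=` ~` [set a] by move=> y Ky ya; apply: nKa; rewrite -ya.
(* The closure of [meeting V] may reach the collapsed point, which need not lie in [meeting U];
   [inside G] cuts it off. *)
have [G [oG KG Ga]] := regular_compact_nbhs Treg (@points_compact K) oa Kna.
have nGa : ~ closure G a by move=> /Ga /(_ erefl).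
exists (meeting V `&` inside G).
  apply: open_nbhs_nbhs; split; last by split=> //; split=> //; exists x.
  apply: openI; first exact: open_meeting.
  by apply: open_inside => // /subset_closure.
move=> L /closureI[/closure_meeting VL /(closure_inside nGa) GL].
have nLa : ~ points L a by move=> /GL.
by case: VL => // -[y [Ly Vy]]; split=> //; exists y; split=> //; exact: VU.
Qed.

Lemma compact_inside (C : set T) : compact C ->
  compact (inside C : set hyperspace).
Proof.
move=> Cc; rewrite compact_ultra => F FU FC.
(* The lower limit of [F]: points all of whose neighborhoods are met by almost every set. *)
pose L := [set x | forall U, open U -> U x ->
  F [set K | points K `&` U !=set0]].
have notL x : ~ L x -> exists U,
    [/\ open U, U x & F [set K | points K `&` U = set0]].
  move=> /existsNP[U /not_implyP[oU /not_implyP[Ux nFU]]]; exists U; split=> //.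
  have [//|] := in_ultra_setVsetC [set K | points K `&` U !=set0] FU.
  by apply: filterS => K; rewrite /setC/= => /set0P/negP/negPn/eqP.
have LC : L `<=` C.
  move=> x Lx; apply: contrapT => nCx.
  have := Lx _ (closed_openC (compact_closed Thaus Cc)) nCx.
  move=> /(filterI FC) /filter_ex[K [KC [y [Ky]]]]; apply; exact: KC.
have Lb : L b.
  move=> U oU Ub; apply: filterS filterT => K _.
  by exists b; split=> //; exact: points_b.
have Lcl : closed L.
  move=> x clx U oU Ux; have [y [Ly Uy]] := clx U (open_nbhs_nbhs (conj oU Ux)).
  exact: Ly.
have Lc : compact L by exact: subclosed_compact Lcl Cc LC.
(* If [a] is in [L], the limit is the collapsed point; otherwise it is [L] itself. *)
have [La|nLa] := pselect (L a).
  exists hyper_collapsed; split; first by move=> x [->|->]; exact: LC.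
  apply: hyperspace_cvg => [U _ Ua /(_ a)|U oU [_ Ua]].
    by case/(_ _)/Ua; left.
  have {}Ua : U a by apply: Ua; left.
  by apply: filterS (La _ oU Ua) => K KU; split.
have La' : L a -> L = [set a; b] by [].
exists (Hyperpoint Lc Lb La'); split=> //.
have [W [oW Wa FW]] := notL _ nLa.
have FnKa : F [set K | ~ points K a].
  apply: filterS FW => K /= KW Ka.
  suff : set0 a by [].
  by rewrite -KW.
apply: hyperspace_cvg => [U oU Ua /= LU|U oU [[x [Lx Ux]] _]].
  have cCU : compact (C `\` U).
    apply: (subclosed_compact _ Cc (@subDsetl _ _ _)).
    rewrite setDE; apply: closedI; last exact: open_closedC.
    exact: compact_closed Thaus Cc.
  (* Each point of [C] outside [U] has a neighborhood missed by almost every set; compactness makes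
     this uniform. *)
  have FCU : F [set K | C `\` U `<=` [set x | ~ points K x]].
    apply: ((compact_near_coveringP _).1 cCU _ F (fun K x => ~ points K x)).
    move=> x [Cx nUx].
    have [V [oV Vx FV]] := notL x (fun Lx => nUx (LU x Lx)).
    exists (V, [set K | points K `&` V = set0]).
      by split=> //; exact: open_nbhs_nbhs.
    move=> [y K] [/= Vy KV] Ky; suff : set0 y by [].
    by rewrite -KV.
  apply: filterS2 FC FCU => K KC KCU x Kx.
  apply: contrapT => nUx; apply: (KCU x) => //; split=> //; exact: KC.
by apply: filterS2 FnKa (Lx _ oU Ux) => K nKa KU; split.
Qed.

(** The members of [A] all lie in one compact [C], so the closure of [A] stays in the compact set
    [inside C]. *)
Lemma card_bounded_hyperspace (K : Type) :
  (forall Q : K -> set T, (forall k, compact (Q k)) ->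
    exists2 C, compact C & forall k, Q k `<=` C) ->
  card_bounded K hyperspace.
Proof.
move=> Tbnd A AK; have [->|/set0P A0] := eqVneq A set0.
  by rewrite closure0; exact: compact0.
have [e Ae] := card_le_range A0 AK.
have [C Cc eC] := Tbnd (fun k => points (e k)) (fun k => @points_compact _).
have Cic := compact_inside Cc.
apply: (subclosed_compact (@closed_closure _ A) Cic).
have cl_inside : closed (inside C : set hyperspace).
  apply: compact_closed Cic.
  exact: regular_accessible_hausdorff accessible_hyperspace regular_hyperspace.
rewrite ((closure_id _).1 cl_inside); apply: closureS.
by rewrite Ae => _ [k _ <-]; exact: eC.
Qed.

(** At [t = a] the union would contain [a], where [points_a] imposes the collapsed
    representative. *)
Definition adjoin (K : hyperspace) (nKa : ~ points K a) (t : T) : hyperspace.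
Proof.
case: (pselect (t = a)) => [_|ta]; first exact: hyper_collapsed.
exists (points K `|` [set t]).
- by apply: compactU; [exact: points_compact|exact: compact_set1].
- by left; exact: points_b.
- by move=> [/nKa//|/esym /ta].
Defined.

Lemma points_adjoin K nKa t : t <> a ->
  points (@adjoin K nKa t) = points K `|` [set t].
Proof. by move=> ta; rewrite /adjoin; case: pselect. Qed.

Lemma adjoin_a K nKa : @adjoin K nKa a = hyper_collapsed.
Proof. by rewrite /adjoin; case: pselect. Qed.

Lemma adjoin_b K nKa : @adjoin K nKa b = K.
Proof.
have ba : b <> a by move=> ba; apply: nKa; rewrite -ba; exact: points_b.
apply: hyperpoint_inj; rewrite points_adjoin// setUidl// => _ ->.
exact: points_b.
Qed.

Lemma points_adjoin_sub K nKa t : points (@adjoin K nKa t) t.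
Proof.
have [->|/eqP ta] := eqVneq t a; first by rewrite adjoin_a; left.
by rewrite points_adjoin//; right.
Qed.

Lemma meeting_adjoin K nKa U t : U t -> meeting U (@adjoin K nKa t).
Proof.
move=> Ut; split; first by exists t; split=> //; exact: points_adjoin_sub.
have [<-//|/eqP ta] := eqVneq t a.
by rewrite points_adjoin// => -[/nKa//|at_]; case: ta.
Qed.

Lemma adjoin_continuous K nKa : continuous (@adjoin K nKa).
Proof.
move=> t; apply: hyperspace_cvg => [U oU Ua tU|U oU tU].
  have ta : t <> a.
    by move=> ta; apply/Ua/tU; rewrite ta adjoin_a; left.
  have Ut : U t by apply/tU/points_adjoin_sub.
  have KU : points K `<=` U.
    by move=> x Kx; apply: tU; rewrite points_adjoin//; left.
  suff : nbhs t U.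
    apply: filterS => s Us.
    have sa : s <> a by move=> sa; apply: Ua; rewrite -sa.
    by rewrite /= /inside/= points_adjoin// => x [/KU//|->].
  exact: open_nbhs_nbhs.
have [Ut|nUt] := pselect (U t).
  suff : nbhs t U by apply: filterS => s; exact: meeting_adjoin.
  exact: open_nbhs_nbhs.
have ta : t <> a.
  by move=> ta; apply: nUt; case: tU => _; rewrite ta adjoin_a; apply; left.
(* The added point is outside [U], so [K] itself meets [U]; near [t] it suffices to avoid [a]. *)
have [x [Kx Ux]] : points K `&` U !=set0.
  case: tU => -[x []]; rewrite points_adjoin// => -[Kx|->//] Ux _.
  by exists x.
suff : nbhs t (~` [set a]).
  apply: filterS => s /= sa; split.
    by exists x; rewrite points_adjoin//; split=> //; left.
  by rewrite points_adjoin// => -[/nKa//|as_]; case: sa.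
apply: open_nbhs_nbhs; split=> //.
exact/closed_openC/accessible_closed_set1.
Qed.

Lemma hyperspace_constant (Y : topologicalType) (f : hyperspace -> Y) :
  (forall g : T -> Y, continuous g -> g a = g b) -> continuous f ->
  forall K, f K = f hyper_collapsed.
Proof.
move=> gab fc K; have [Ka|nKa] := pselect (points K a).
  by rewrite (hyper_collapsedP Ka).
rewrite -{1}(adjoin_b nKa) -(adjoin_a nKa).
apply/esym/(gab (f \o adjoin nKa)) => t.
by apply: continuous_comp; [exact: adjoin_continuous|exact: fc].
Qed.

Lemma infinite_hyperspace : a <> b -> infinite_set [set: T] ->
  infinite_set [set: hyperspace].
Proof.
move=> ab Tinf finH; apply: Tinf; apply: card_le_finite finH.
have cbt t : compact [set b; t] by apply: compactU; exact: compact_set1.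
have bbt t : [set b; t] b by left.
have abt t : [set b; t] a -> [set b; t] = [set a; b].
  by move=> [//|<-]; rewrite setUC.
apply: (@inj_card_leT _ _ (fun t => Hyperpoint (cbt t) (bbt t) (@abt t))).
move=> t s /(congr1 points) /= E.
have : [set b; s] t by rewrite -E; right.
have : [set b; t] s by rewrite E; right.
by move=> [->|->//] [->|].
Qed.

End continua.

(** * The corkscrew and its separation properties *)

Lemma accessible_neq_nbhs (T : topologicalType) (x y : T) :
  accessible_space T -> x <> y -> nbhs x (~` [set y]).
Proof.
move=> T1 xy; apply: open_nbhs_nbhs; split=> //.
exact/closed_openC/accessible_closed_set1.
Qed.

Lemma fmap_ultra (T U : Type) (f : T -> U) (F : set_system T) :
  UltraFilter F -> UltraFilter (f @ F).
Proof.
move=> FU; split=> [|G GF FG]; first exact: fmap_proper_filter.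
apply/seteqP; split=> // A GA.
have [//|FA] := in_ultra_setVsetC (f @^-1` A) FU.
have /(filterI GA) : G (~` A) by exact: FG.
by rewrite setICr => /filter_ex[].
Qed.

Lemma fiber_nbhs (K : Type) (X Y : topologicalType) (f : X -> Y) (p : X) :
  local_pseudobases_le K Y -> continuous f ->
  exists2 A : K -> set X, forall k, nbhs p (A k) &
    \bigcap_k A k `<=` [set q | f q = f p].
Proof.
move=> YK fc; have [F [FK Fo FE]] := YK (f p).
have [F0|/set0P F0] := eqVneq F set0.
  (* An empty family has intersection [Y], which is then the single point [f p]. *)
  exists (fun=> setT) => [k|q _ /=]; first exact: filterT.
  have : (\bigcap_(U in F) U) (f q) by rewrite F0.
  by rewrite FE.
have [e Fe] := card_le_range F0 FK.
have Fek k : F (e k) by rewrite Fe; exists k.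
exists (fun k => f @^-1` e k) => [k|q Aq].
  apply: fc; apply: open_nbhs_nbhs; split; first exact: Fo.
  have : [set f p] (f p) by [].
  by rewrite -FE; apply.
suff : [set f p] (f q) by [].
rewrite -FE => U; rewrite Fe => -[k _ <-]; exact: Aq.
Qed.

Section corkscrew.
Variables (C1 C2 : topologicalType) (o1 : C1) (o2 : C2).

(* The planks, copies of [C1 * C2], sit at even levels and are glued alternately
   along the edges [{o1} * C2] (levels 1 mod 4) and [C1 * {o2}] (levels 3
   mod 4); no point lies over (o1, o2). *)
Definition on_level (x : C1) (y : C2) (h : int) : Prop :=
  `[< x = o1 >] = ((h %% 4)%Z == 1%R) /\ `[< y = o2 >] = ((h %% 4)%Z == 3%R).

Inductive corkscrew : Type :=
| Pt (x : C1) (y : C2) (h : int) of on_level x y h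
| End of bool.

(** A point on an edge (odd level) is close to the two planks glued there, a point inside a plank
    only to its own level. *)
Definition star (h h' : int) : Prop :=
  h' = h \/ (h %% 2)%Z = 1%R /\ (h' = h + 1 \/ h' = h - 1)%R.

Definition box (U : set C1) (V : set C2) (h : int) : set corkscrew :=
  [set p | if p is Pt x y h' _ then [/\ U x, V y & star h h'] else False].

Definition beyond (e : bool) (n h : int) : Prop :=
  if e then (n < h)%R else (h < - n)%R.

Definition tail (e : bool) (n : int) : set corkscrew :=
  [set p | match p with Pt _ _ h _ => beyond e n h | End e' => e' = e end].

Definition corkscrew_nbhs (p : corkscrew) : set_system corkscrew :=
  match p with
  | Pt x y h _ => filter_from (fun UV => nbhs x UV.1 /\ nbhs y UV.2)
                              (fun UV => box UV.1 UV.2 h)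
  | End e => filter_from setT (tail e)
  end.

Lemma tail_anti e m n : (m <= n)%R -> tail e n `<=` tail e m.
Proof. by move=> mn [x y h g|//]; case: e => /=; rewrite /beyond; lia. Qed.

Lemma corkscrew_nbhs_filter p : ProperFilter (corkscrew_nbhs p).
Proof.
case: p => [x y h g|e]; apply: filter_from_proper.
- apply: filter_from_filter.
    by exists (setT, setT); split; exact: filterT.
  move=> [U V] [U' V'] [/= xU yV] [/= xU' yV'].
  exists (U `&` U', V `&` V'); first by split; exact: filterI.
  by move=> [x' y' h' g'|//] [[? ?] [? ?] ?].
- move=> [U V] [/= xU yV]; exists (Pt g).
  by split; [exact: nbhs_singleton|exact: nbhs_singleton|left].
- apply: filter_from_filter; first by exists 0%R.
  move=> m n _ _; exists (Num.max m n) => //.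
  by rewrite subsetI; split; apply: tail_anti; lia.
- by move=> n _; exists (End e).
Qed.

Lemma corkscrew_nbhs_singleton p A : corkscrew_nbhs p A -> A p.
Proof.
case: p => [x y h g [[U V] [xU yV]]|e [n _]]; apply => //=.
by split; [exact: nbhs_singleton|exact: nbhs_singleton|left].
Qed.

Lemma corkscrew_nbhs_nbhs p A :
  corkscrew_nbhs p A -> corkscrew_nbhs p (corkscrew_nbhs^~ A).
Proof.
case: p => [x y h g [[U V] [/= xU yV] A_box]|e [n _ A_tail]] /=.
  exists (U°, V°) => /=; first by split; exact: nbhs_interior.
  move=> [x' y' h' g'|//] [Ux' Vy' hh'] /=; exists (U, V) => //=.
  move=> [x'' y'' h'' g''|//] [Ux'' Vy'' hh'']; apply: A_box.
  by split=> //; move: hh' hh''; rewrite /star; lia.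
(* The margin of one level absorbs the reach of [star]. *)
exists (n + 1)%R => // -[x y h g|e' /= ->] /=; last by exists n.
move=> he; exists (setT, setT); first by split; exact: filterT.
move=> [x' y' h' g'|//] [_ _ hh'] /=; apply: A_tail => /=.
by move: he hh'; rewrite /star /beyond; case: e; lia.
Qed.

HB.instance Definition _ := gen_eqMixin corkscrew.
HB.instance Definition _ := gen_choiceMixin corkscrew.
HB.instance Definition _ := hasNbhs.Build corkscrew corkscrew_nbhs.
HB.instance Definition _ := Nbhs_isNbhsTopological.Build corkscrew
  corkscrew_nbhs_filter corkscrew_nbhs_singleton corkscrew_nbhs_nbhs.

Lemma nbhs_Pt x y h (g : on_level x y h) (A : set corkscrew) :
  nbhs (Pt g) A <->
  exists U V, [/\ nbhs x U, nbhs y V & box U V h `<=` A].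
Proof.
split=> [[[U V] [xU yV] UVA]|[U [V [xU yV UVA]]]].
  by exists U, V.
by exists (U, V); [split|].
Qed.

Lemma nbhs_box x y h (g : on_level x y h) U V :
  nbhs x U -> nbhs y V -> nbhs (Pt g) (box U V h).
Proof. by move=> xU yV; apply/nbhs_Pt; exists U, V; split=> // q. Qed.

Lemma nbhs_End e (A : set corkscrew) :
  nbhs (End e) A <-> exists n, tail e n `<=` A.
Proof. by split=> [[n _ ?]|[n ?]]; exists n. Qed.

Lemma nbhs_tail e n : nbhs (End e) (tail e n).
Proof. by apply/nbhs_End; exists n => q. Qed.

Lemma Pt_eq x y h (g : on_level x y h) x' y' h' (g' : on_level x' y' h') :
  x = x' -> y = y' -> h = h' -> Pt g = Pt g'.
Proof.
by move=> xx' yy' hh'; subst; congr Pt; exact: Prop_irrelevance.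
Qed.

Lemma accessible_corkscrew : accessible_space C1 -> accessible_space C2 ->
  accessible_space corkscrew.
Proof.
move=> T1 T2 p q /eqP pq; exists (~` [set q]); rewrite !inE.
split=> //; last exact.
rewrite openE => {pq}p /= pq; rewrite /interior.
case: p q pq => [x y h g|e] [x' y' h' g'|e'] pq.
- have [xx'|xx'] := pselect (x = x'); last first.
    apply/nbhs_Pt; exists (~` [set x']), setT.
    split; [exact: accessible_neq_nbhs|exact: filterT|].
    by move=> [x'' y'' h'' g''|//] [/= xx'' _ _] [].
  have [yy'|yy'] := pselect (y = y'); last first.
    apply/nbhs_Pt; exists setT, (~` [set y']).
    split; [exact: filterT|exact: accessible_neq_nbhs|].
    by move=> [x'' y'' h'' g''|//] [/= _ yy'' _] [].
  (* With equal coordinates, two distinct levels cannot be adjacent: exactly one of them would be an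
     edge level. *)
  apply/nbhs_Pt; exists setT, setT; split; [exact: filterT|exact: filterT|].
  move=> [x'' y'' h'' g''|//] [/= _ _ hh''] [_ _ h''h']; subst.
  have hh' : h <> h' by move=> hh'; apply: pq; exact: Pt_eq.
  by move: (g) (g') hh' hh''; rewrite /on_level /star; lia.
- apply/nbhs_Pt; exists setT, setT; split; [exact: filterT|exact: filterT|].
  by move=> [].
- apply/nbhs_End; exists `|h'|%R => -[x'' y'' h'' g''|//] /= hh'' [_ _ h''h'].
  by move: hh''; rewrite h''h' /beyond; case: e {pq}; lia.
- by apply/nbhs_End; exists 0%R => -[//|e'' /= ->].
Qed.

Lemma regular_corkscrew :
  accessible_space C1 -> accessible_space C2 ->
  regular_space C1 -> regular_space C2 -> regular_space corkscrew.
Proof.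
move=> T1 T2 R1 R2.
(* The last clause keeps the closure of a box off any edge that does not contain its centre. *)
have shrink (C : topologicalType) (o x : C) (U : set C) : accessible_space C ->
    regular_space C -> nbhs x U ->
    exists V, [/\ nbhs x V, closure V `<=` U & closure V o -> x = o].
  move=> CT CR xU; have [xo|xo] := pselect (x = o).
    by have [V xV VU] := CR x _ xU; exists V.
  have [|V xV VU] := CR x (U `&` ~` [set o]).
    by apply: filterI => //; exact: accessible_neq_nbhs.
  by exists V; split=> // [z /VU[]//|/VU[_ /(_ erefl)]].
move=> [x y h g|e] A.
  move/nbhs_Pt=> [U [V [xU yV UVA]]].
  have [U' [xU' U'U U'o]] := shrink _ o1 _ _ T1 R1 xU.
  have [V' [yV' V'V V'o]] := shrink _ o2 _ _ T2 R2 yV.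
  exists (box U' V' h); first exact: nbhs_box.
  move=> [x' y' h' g'|e]; last first.
    move=> /(_ _ (nbhs_tail e (`|h| + 1)%R)) [[x' y' h' g'|e'] []//= [_ _]].
    by rewrite /star /beyond; case: e; lia.
  move=> cl; apply: UVA.
  have x'U : closure U' x'.
    move=> B x'B; have [[x'' y'' h'' g''|e] []//= [? _ _] [? _ _]] :=
      cl _ (nbhs_box g' x'B (filterT)).
    by exists x''.
  have y'V : closure V' y'.
    move=> B y'B; have [[x'' y'' h'' g''|e] []//= [_ ? _] [_ ? _]] :=
      cl _ (nbhs_box g' (filterT) y'B).
    by exists y''.
  have [[x'' y'' h'' g''|e] []//= [_ _ hh''] [_ _ h'h'']] :=
    cl _ (nbhs_box g' (filterT) (filterT)).
  split; [exact: U'U|exact: V'V|].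
  have {}U'o : `[< x' = o1 >] -> `[< x = o1 >].
    by move=> /asboolP E; apply/asboolP/U'o; rewrite -E.
  have {}V'o : `[< y' = o2 >] -> `[< y = o2 >].
    by move=> /asboolP E; apply/asboolP/V'o; rewrite -E.
  (* Both [h] and [h'] reach [h'']. If [star h h'] failed, [h'] would be the level of an edge not
     containing the centre, against [U'o] and [V'o]. *)
  by move: (g) (g') hh'' h'h'' U'o V'o; rewrite /on_level /star; lia.
(* The margin exceeds the reach of a box, and a nonnegative bound separates the tail from
   [tail e' 0] at the other end. *)
move/nbhs_End => [n nA]; exists (tail e (`|n| + 2)%R); first exact: nbhs_tail.
move=> [x y h g|e'] cl; apply: nA => /=.
  have [[x'' y'' h'' g''|e'] []//=] := cl _ (nbhs_box g filterT filterT).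
  by move=> + [_ _]; rewrite /beyond /star; case: e {cl}; lia.
have [[x'' y'' h'' g''|e''] []//=] := cl _ (nbhs_tail e' 0%R).
  2: by move=> ->.
by rewrite /beyond; case: e {cl}; case: e'; lia.
Qed.


(** * Compactness in the corkscrew *)

Definition level (h : int) : set corkscrew :=
  [set p | if p is Pt _ _ h' _ then h' = h else False].

Definition coord1 (p : corkscrew) : C1 := if p is Pt x _ _ _ then x else o1.

Definition coord2 (p : corkscrew) : C2 := if p is Pt _ y _ _ then y else o2.

(** An ultrafilter converging to neither end avoids a tail at each, so it lives on finitely many
    levels and hence on one. *)
Lemma ultra_level (F : set_system corkscrew) : UltraFilter F ->
  (exists e, F --> End e) \/ exists h, F (level h).
Proof.
move=> FU; have [?|nE] := pselect (exists e, F --> End e); [by left|right].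
have nT e : exists n, F (~` tail e n).
  apply: contrapT => /forallNP nT; apply: nE; exists e => A /nbhs_End[n nA].
  have [|/nT//] := in_ultra_setVsetC (tail e n) FU.
  exact: filterS.
have [m Fm] := nT true; have [n Fn] := nT false.
have lvl (k : nat) (a : int) :
    F [set p | if p is Pt _ _ h _ then (a <= h < a + k%:Z)%R else False] ->
    exists h, F (level h).
  elim: k => [|k IH] Fk.
    by have [[x y h g|//] /=] := filter_ex Fk; lia.
  have [Fl|nFl] := in_ultra_setVsetC (level (a + k%:Z)%R) FU.
    by exists (a + k%:Z)%R.
  apply: IH; apply: filterS2 Fk nFl => -[x y h g|//] /= hk hl.
  by have : h <> (a + k%:Z)%R; [exact: hl|lia].
apply: (lvl (absz (m + n + 1)%R) (- n)%R).
apply: filterS2 Fm Fn => -[x y h g|e] /=.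
  by rewrite /beyond /setC /=; lia.
by case: e => [/(_ erefl)|_ /(_ erefl)].
Qed.

(** Limits can be missing only over the corner [(o1, o2)], which is cut out with a neighborhood on
    every level. *)
Lemma compact_corkscrew_setC (N : set C1) (N' : set C2) :
  accessible_space C1 -> accessible_space C2 ->
  compact [set: C1] -> compact [set: C2] ->
  nbhs o1 N -> nbhs o2 N' -> open N -> open N' ->
  compact [set p | if p is Pt x y _ _ then ~ (N x /\ N' y) else True].
Proof.
move=> T1 T2 c1 c2 o1N o2N' oN oN'; rewrite compact_ultra => F FU FA.
have [[e Fe]|[h Fh]] := ultra_level FU; first by exists (End e).
move: c1 c2; rewrite !compact_ultra.
move=> /(_ _ (fmap_ultra coord1 FU) filterT)[x [_ /= Fx]].
move=> /(_ _ (fmap_ultra coord2 FU) filterT)[y [_ /= Fy]].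
have xyN : ~ (N x /\ N' y).
  move=> [Nx N'y].
  have FN : F (coord1 @^-1` N) by apply: Fx; exact: open_nbhs_nbhs.
  have FN' : F (coord2 @^-1` N') by apply: Fy; exact: open_nbhs_nbhs.
  have [p [[pA [pN pN']] ph]] :=
    filter_ex (filterI (filterI FA (filterI FN FN')) Fh).
  case: p pA pN pN' ph => // x' y' h' g' /= nN Nx' N'y' _.
  by apply: nN; split.
have x1 : (h %% 4)%Z == 1%R -> `[< x = o1 >].
  move=> h1; apply/asboolP; apply: contrapT => /(accessible_neq_nbhs T1) /Fx.
  move=> Fo; have {}Fo : F (coord1 @^-1` (~` [set o1])) := Fo.
  have [p [ph]] := filter_ex (filterI Fh Fo); apply.
  case: p ph => [x' y' h' g' /= h'h|//].
  by apply/asboolP; have [-> _] := g'; rewrite h'h.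
have y3 : (h %% 4)%Z == 3%R -> `[< y = o2 >].
  move=> h1; apply/asboolP; apply: contrapT => /(accessible_neq_nbhs T2) /Fy.
  move=> Fo; have {}Fo : F (coord2 @^-1` (~` [set o2])) := Fo.
  have [p [ph]] := filter_ex (filterI Fh Fo); apply.
  case: p ph => [x' y' h' g' /= h'h|//].
  by apply/asboolP; have [_ ->] := g'; rewrite h'h.
have xy : ~~ (`[< x = o1 >] && `[< y = o2 >]).
  apply/negP => /andP[/asboolP xo /asboolP yo]; apply: xyN; split.
    by rewrite xo; exact: nbhs_singleton.
  by rewrite yo; exact: nbhs_singleton.
(* The limit of points of a plank may lie on an edge; its level is then the neighboring odd one of
   the right residue. *)
have [h0 [g h0h]] : exists h0, on_level x y h0 /\ star h0 h.
  move: x1 y3 xy; rewrite /on_level /star.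
  case: `[< x = o1 >]; case: `[< y = o2 >] => // x1 y3 _.
  - have [?|[?|?]] : ((h %% 4)%Z = 0 \/ (h %% 4)%Z = 1 \/
                     (h %% 4)%Z = 2)%R by lia.
    + by exists (h + 1)%R; lia.
    + by exists h; lia.
    + by exists (h - 1)%R; lia.
  - have [?|[?|?]] : ((h %% 4)%Z = 2 \/ (h %% 4)%Z = 3 \/
                     (h %% 4)%Z = 0)%R by lia.
    + by exists (h + 1)%R; lia.
    + by exists h; lia.
    + by exists (h - 1)%R; lia.
  - by exists h; lia.
exists (Pt g); split=> // B /nbhs_Pt[U [V [xU yV UVB]]].
have FU' : F (coord1 @^-1` U) by exact: Fx.
have FV : F (coord2 @^-1` V) by exact: Fy.
apply: filterS (filterI (filterI FU' FV) Fh).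
by move=> [x' y' h' g'|e] [[/= Ux' Vy'] //= h'h]; apply: UVB; rewrite /= h'h.
Qed.

(** No point lies over the corner, so each point of [Q] is separated from it on level [h];
    near-covering compactness makes this uniform. *)
Lemma compact_avoids_corner (Q : set corkscrew) (h : int) :
  hausdorff_space C1 -> hausdorff_space C2 -> compact Q ->
  exists N N', [/\ nbhs o1 N, nbhs o2 N' &
    forall x y (g : on_level x y h), N x -> N' y -> ~ Q (Pt g)].
Proof.
move=> H1 H2 /compact_near_coveringP Qc.
have sep (C : topologicalType) (z o : C) : hausdorff_space C -> z <> o ->
    exists A B, [/\ nbhs z A, nbhs o B & A `&` B = set0].
  rewrite open_hausdorff => CH /eqP /CH[[A B] /= []].
  rewrite !inE => zA oB [oA oB' AB]; exists A, B.
  by split; [exact: open_nbhs_nbhs|exact: open_nbhs_nbhs|].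
have [q Qq|[N N'] [/= o1N o2N'] NQ] := Qc _ (nbhs (o1, o2))
    (fun z q => forall g : on_level z.1 z.2 h, q <> Pt g) _.
  case: q Qq => [x y k g|e] Qq.
    have [xo|xo] := pselect (x = o1).
      have yo : y <> o2.
        move: (g) => [] /esym + /esym; do 2![case: asboolP => // _].
        by move=> /eqP + /eqP; lia.
      have [A [B [yA oB AB]]] := sep _ _ _ H2 yo.
      exists (box setT A k, setT `*` B) => /=.
        by split; [apply: nbhs_box => //; exact: filterT
                  |exists (setT, B) => //; split=> //; exact: filterT].
      move=> [[x' y' h' g'|//] [x'' y'']] /=.
      move=> [[_ Ay' _] [_ By'']] g'' [_ y'y'' _].
      have : (A `&` B) y' by split=> //; rewrite y'y''.
      by rewrite AB.
    have [A [B [xA oB AB]]] := sep _ _ _ H1 xo.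
    exists (box A setT k, B `*` setT) => /=.
      by split; [apply: nbhs_box => //; exact: filterT
                |exists (B, setT) => //; split=> //; exact: filterT].
    move=> [[x' y' h' g'|//] [x'' y'']] /= [[Ax' _ _] [Bx'' _]] g'' [x'x'' _ _].
    have : (A `&` B) x' by split=> //; rewrite x'x''.
    by rewrite AB.
  exists (tail e `|h|%R, setT) => /=.
    by split; [exact: nbhs_tail|exact: filterT].
  move=> [[x' y' h' g'|//] z] /= [h'_tail _] g'' [_ _ h'h].
  by move: h'_tail; rewrite h'h /beyond; case: (e); lia.
exists N, N'; split=> // x y g Nx N'y Qg.
exact: (NQ (x, y) (conj Nx N'y) _ Qg g).
Qed.

(** Intersecting the corner neighborhoods avoided by [Q k] on level [h], over all [k] and [h], gives
    one corner whose complement is compact and contains every [Q k]. *)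
Lemma corkscrew_bounded (K : Type) :
  hausdorff_space C1 -> hausdorff_space C2 ->
  compact [set: C1] -> compact [set: C2] ->
  P_point (K * int) o1 -> P_point (K * int) o2 ->
  forall Q : K -> set corkscrew, (forall k, compact (Q k)) ->
    exists2 C, compact C & forall k, Q k `<=` C.
Proof.
move=> H1 H2 c1 c2 P1 P2 Q Qc.
have /choice[NN NNP] : forall kh : K * int, exists NN : set C1 * set C2,
    [/\ nbhs o1 NN.1, nbhs o2 NN.2 & forall x y (g : on_level x y kh.2),
       NN.1 x -> NN.2 y -> ~ Q kh.1 (Pt g)].
  move=> [k h]; have [N [N' NNP]] := compact_avoids_corner h H1 H2 (Qc k).
  by exists (N, N').
have o1N : nbhs o1 (\bigcap_kh (NN kh).1) by apply: P1 => kh; have [] := NNP kh.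
have o2N : nbhs o2 (\bigcap_kh (NN kh).2) by apply: P2 => kh; have [] := NNP kh.
have T1 := hausdorff_accessible H1; have T2 := hausdorff_accessible H2.
have := compact_corkscrew_setC T1 T2 c1 c2 (nbhs_interior o1N)
  (nbhs_interior o2N) (@open_interior _ _) (@open_interior _ _).
move=> Cc; eexists; first exact: Cc.
move=> k [x y h g|//] Qg [/interior_subset Nx /interior_subset N'y].
by have [_ _ /(_ x y g)] := NNP (k, h); apply; [exact: Nx|exact: N'y|].
Qed.

(** * Continuous maps on the corkscrew *)

Lemma nbhs_Pt1 x y h (g : on_level x y h) (A : set corkscrew) : nbhs (Pt g) A ->
  nbhs x [set x' | forall h' (g' : on_level x' y h'), star h h' -> A (Pt g')].
Proof.
move=> /nbhs_Pt[U [V [xU yV UVA]]]; apply: filterS xU => x' Ux' h' g' hh'.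
by apply: UVA; split=> //; exact: nbhs_singleton.
Qed.

Lemma nbhs_Pt2 x y h (g : on_level x y h) (A : set corkscrew) : nbhs (Pt g) A ->
  nbhs y [set y' | forall h' (g' : on_level x y' h'), star h h' -> A (Pt g')].
Proof.
move=> /nbhs_Pt[U [V [xU yV UVA]]]; apply: filterS yV => y' Vy' h' g' hh'.
by apply: UVA; split=> //; exact: nbhs_singleton.
Qed.

Lemma on_plank (x : C1) (y : C2) (k : int) : x <> o1 -> y <> o2 ->
  on_level x y (2 * k)%R.
Proof. by move=> xo yo; split; case: asboolP => // _; lia. Qed.

Lemma infinite_corkscrew (x : C1) (y : C2) : x <> o1 -> y <> o2 ->
  infinite_set [set: corkscrew].
Proof.
move=> xo yo; apply/infiniteP.
apply: (@inj_card_leT _ _ (fun n : nat => Pt (on_plank n xo yo))).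
by move=> m n []; lia.
Qed.

(* Along the two lines through well-chosen points x0 and y0, f passes from
   each plank to the next without changing its value. *)
Lemma corkscrew_ends_eq (K : Type) (Y : topologicalType) (f : corkscrew -> Y) :
  P_point K o1 -> P_point int o1 -> P_point K o2 -> P_point (C1 * int) o2 ->
  (forall A, nbhs o1 A -> exists2 x, A x & x <> o1) ->
  (forall A, nbhs o2 A -> exists2 x, A x & x <> o2) ->
  accessible_space Y -> local_pseudobases_le K Y -> continuous f ->
  f (End true) = f (End false).
Proof.
move=> P1K P1Z P2K P2C lim1 lim2 TY YK fc.
have fib1 y h (g : on_level o1 y h) : nbhs o1 [set x |
    forall h' (g' : on_level x y h'), star h h' -> f (Pt g') = f (Pt g)].
  have [A gA AE] := fiber_nbhs (Pt g) YK fc.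
  apply: filterS (P1K _ (fun k => nbhs_Pt1 (gA k))) => x Ax h' g' hh'.
  by apply: AE => k _; exact: Ax.
have fib2 x h (g : on_level x o2 h) : nbhs o2 [set y |
    forall h' (g' : on_level x y h'), star h h' -> f (Pt g') = f (Pt g)].
  have [A gA AE] := fiber_nbhs (Pt g) YK fc.
  apply: filterS (P2K _ (fun k => nbhs_Pt2 (gA k))) => y Ay h' g' hh'.
  by apply: AE => k _; exact: Ay.
(* One [y0] serves all [x] and all levels, hence the index type [C1 * int]; pairs with no point over
   [o2] impose no condition. *)
have /lim2[y0 y0P y0o] : nbhs o2 (\bigcap_xh [set y |
    forall (g : on_level xh.1 o2 xh.2) h' (g' : on_level xh.1 y h'),
    star xh.2 h' -> f (Pt g') = f (Pt g)]).
  apply: P2C => -[x h] /=; have [g|ng] := pselect (on_level x o2 h).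
    by apply: filterS (fib2 _ _ g) => y yP g'; rewrite (Prop_irrelevance g' g).
  by apply: filterS filterT => y _ g; case: (ng g).
have /lim1[x0 x0P x0o] : nbhs o1 (\bigcap_h [set x |
    forall (g : on_level o1 y0 h) h' (g' : on_level x y0 h'),
    star h h' -> f (Pt g') = f (Pt g)]).
  apply: P1Z => h /=; have [g|ng] := pselect (on_level o1 y0 h).
    by apply: filterS (fib1 _ _ g) => x xP g'; rewrite (Prop_irrelevance g' g).
  by apply: filterS filterT => x _ g; case: (ng g).
pose p k := Pt (on_plank k x0o y0o).
have pS k : f (p k) = f (p (k + 1)%R).
  (* The planks at levels [2 * k] and [2 * k + 2] share the edge at [2 * k + 1], and [f] has on both
     the value at its point over [y0] or [x0]. *)
  have [h1|h3] :
      ((2 * k + 1) %% 4)%Z = 1%R \/ ((2 * k + 1) %% 4)%Z = 3%R by lia.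
    have g : on_level o1 y0 (2 * k + 1)%R.
      by split; rewrite h1; case: asboolP.
    have st h : star (2 * k + 1)%R h ->
        forall g' : on_level x0 y0 h, f (Pt g') = f (Pt g).
      by move=> hh' g'; apply: (x0P (2 * k + 1)%R).
    by rewrite !st// /star; lia.
  have g : on_level x0 o2 (2 * k + 1)%R.
    by split; rewrite h3; case: asboolP.
  have st h : star (2 * k + 1)%R h ->
      forall g' : on_level x0 y0 h, f (Pt g') = f (Pt g).
    by move=> hh' g'; apply: (y0P (x0, (2 * k + 1)%R)).
  by rewrite !st// /star; lia.
have pE k : f (p k) = f (p 0%R).
  elim/int_rect : k => // n IH.
    by rewrite -IH [RHS]pS; congr (f (p _)); lia.
  by rewrite -IH [LHS]pS; congr (f (p _)); lia.
suff fE e : f (End e) = f (p 0%R) by rewrite !fE.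
(* Otherwise a whole tail would avoid the value [f (p 0)], yet it contains some [p k]. *)
apply: contrapT => /(accessible_neq_nbhs TY)/fc/nbhs_End[n nA].
pose k : int := (if e then `|n| + 1 else - (`|n| + 1))%R.
have /nA : tail e n (p k) by rewrite /= /k /beyond; case: (e); lia.
by apply; exact: pE.
Qed.

End corkscrew.

(** * Choice of the two compact spaces and conclusion *)

Theorem theorem3 (K : Type) (K_infinite : infinite_set [set: K]) :
  exists R : topologicalType,
    [/\ infinite_set [set: R],
        accessible_space R /\ regular_space R,
        card_bounded K R &
        forall (Y : topologicalType) (L : Type),
          accessible_space Y ->
          is_pseudo_character Y L -> [set: L] #<= [set: K] ->
          forall f : R -> Y, continuous f -> exists c : Y, forall x : R, f x = c].
Proof.
have [k0 _] : [set: K] !=set0.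
  by apply/set0P/eqP => K0; apply: K_infinite; rewrite K0.
(* One index for each pair of a member of [K] and a level of the corkscrew. *)
pose J1 := (K * int)%type.
have J1_neq : (k0, 0%R) <> (k0, 1%R) :> J1 by case.
pose C1 := cut_space J1; pose o1 : C1 := cut_top J1.
have P1 : P_point J1 o1 := cut_top_P_point J1_neq.
(* The point [o2] must also absorb one neighborhood for each point of [C1] and each level, so [C2]
   is built after [C1]. *)
pose J2 := (J1 + C1 * int)%type.
have J2_neq : inl (k0, 0%R) <> inl (k0, 1%R) :> J2 by case.
pose C2 := cut_space J2; pose o2 : C2 := cut_top J2.
have P2 : P_point J2 o2 := cut_top_P_point J2_neq.
have P2_1 : P_point J1 o2 by apply: P_point_inj P2; exact: inl_inj.
have P2_C1 : P_point (C1 * int) o2 by apply: P_point_inj P2; exact: inr_inj.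
have K_J1 : injective (fun k : K => (k, 0%R) : J1) by move=> k l [].
have int_J1 : injective (fun h : int => (k0, h) : J1) by move=> h h' [].
have H1 : hausdorff_space C1 := @cut_space_hausdorff J1.
have H2 : hausdorff_space C2 := @cut_space_hausdorff J2.
have c1 : compact [set: C1] := @cut_space_compact J1.
have c2 : compact [set: C2] := @cut_space_compact J2.
have T1 := hausdorff_accessible H1; have T2 := hausdorff_accessible H2.
have R1 : regular_space C1 by move=> x; exact: compact_regular H1 c1 filterT.
have R2 : regular_space C2 by move=> x; exact: compact_regular H2 c2 filterT.
pose X : topologicalType := corkscrew o1 o2.
have TX : accessible_space X := accessible_corkscrew T1 T2.
have RX : regular_space X := regular_corkscrew T1 T2 R1 R2.
pose a : X := End o1 o2 true; pose b : X := End o1 o2 false.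
have lim1 A : nbhs o1 A -> exists2 x, A x & x <> o1 := cut_top_limit J1_neq.
have lim2 A : nbhs o2 A -> exists2 x, A x & x <> o2 := cut_top_limit J2_neq.
exists (hyperspace a b); split.
- have [x _ xo] := lim1 _ (@filterT _ (nbhs o1) _).
  have [y _ yo] := lim2 _ (@filterT _ (nbhs o2) _).
  by apply: infinite_hyperspace => //; exact: infinite_corkscrew xo yo.
- by split; [exact: accessible_hyperspace|exact: regular_hyperspace].
- by apply: card_bounded_hyperspace => //; exact: corkscrew_bounded.
- move=> Y L TY [_ YL _] LK f fc.
  exists (f (hyper_collapsed a b)); apply: hyperspace_constant => // g gc.
  apply: (@corkscrew_ends_eq _ _ o1 o2 K) => //.
  + exact: P_point_inj K_J1 P1.
  + exact: P_point_inj int_J1 P1.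
  + exact: P_point_inj K_J1 P2_1.
  + exact: local_pseudobases_leW LK YL.
Qed.
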